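(* The domain $\mathrm{dom}(\mathfrak{t}_\alpha)$ of $\mathfrak{t}_\alpha$ does not depend on $\alpha>-1$ and consists of those $u\in\ell^2(\mathbb{Z}_{\ge0})$ for which the series $$\sum_{n\ge0}(n+1)\big|u_n-u_{n+1}\big|^2$$ is finite. Moreover, for every $u\in\mathrm{dom}(\mathfrak{t}_\alpha)$ the form $\mathfrak{t}_\alpha$ admits the representation $$\mathfrak{t}_\alpha[u]=\sum_{n\ge0}\big|\sqrt{n+\alpha+1}\,u_n-\sqrt{n+1}\,u_{n+1}\big|^2.$$
   Context: For $\alpha>-1$ and a complex sequence $u=(u_n)_{n\ge 0}$ (with $u_{-1}:=0$) put $$(\tau_\alpha u)_n=-\sqrt{n(n+\alpha)}\,u_{n-1}+(2n+1+\alpha)u_n-\sqrt{(n+1)(n+1+\alpha)}\,u_{n+1},\quad n\ge 0.$$ The discrete Laguerre operator $H_\alpha$ in $\ell^2(\mathbb{Z}_{\ge 0})$ is $H_\alpha u=\tau_\alpha u$ with domain $\{u\in\ell^2(\mathbb{Z}_{\ge0}) : \tau_\alpha u\in\ell^2(\mathbb{Z}_{\ge0})\}$; it is self-adjoint and nonnegative. The form $\mathfrak{t}_\alpha$ is the closure of the quadratic form $u\mapsto\langle H_\alpha u,u\rangle_{\ell^2}$, $u\in\mathrm{dom}(H_\alpha)$; explicitly $\mathfrak{t}_\alpha[u]=\|\sqrt{H_\alpha}u\|_{\ell^2}^2$ with $\mathrm{dom}(\mathfrak{t}_\alpha)=\mathrm{dom}(\sqrt{H_\alpha})$, where $\sqrt{H_\alpha}$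 is the nonnegative self-adjoint square root. *)

(* Defs.v *)
From Stdlib Require Import Reals.
From Coquelicot Require Import Coquelicot.
Open Scope R_scope.

Definition cseq := nat -> C.

Definition seq_minus (u v : cseq) : cseq := fun n => Cminus (u n) (v n).

Definition in_l2 (u : cseq) : Prop := ex_series (fun n => (Cmod (u n)) ^ 2).

Definition l2_norm (u : cseq) : R := sqrt (Series (fun n => (Cmod (u n)) ^ 2)).

Definition CSeries (a : nat -> C) : C :=
  (Series (fun n => Re (a n)), Series (fun n => Im (a n))).

(* Linear in the first argument. Both arguments are meant to be in l^2; the
   series then converges absolutely. *)
Definition l2_inner (u v : cseq) : C :=
  CSeries (fun n => Cmult (u n) (Cconj (v n))).

(* [shift u n] is u_{n-1}, with u_{-1} := 0. *)
Definition shift (u : cseq) : cseq :=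
  fun n => match n with O => RtoC 0 | S m => u m end.

Definition tau (alpha : R) (u : cseq) : cseq := fun n =>
  (- RtoC (sqrt (INR n * (INR n + alpha))) * shift u n
   + RtoC (2 * INR n + 1 + alpha) * u n
   - RtoC (sqrt ((INR n + 1) * (INR n + 1 + alpha))) * u (S n))%C.

Definition dom_H (alpha : R) (u : cseq) : Prop :=
  in_l2 u /\ in_l2 (tau alpha u).

Definition H_form (alpha : R) (u : cseq) : C := l2_inner (tau alpha u) u.

(* Closure of a quadratic form [q] with domain the linear subspace [D] of l^2
   (Kato): [form_approx D q w u] says that the sequence [w] of elements of [D]
   is q-convergent to [u]; the closure is defined at those u for which such a w
   exists, and its value there is the limit of q[w_k]. *)
Definition form_approx (D : cseq -> Prop) (q : cseq -> C)
    (w : nat -> cseq) (u : cseq) : Prop :=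
  in_l2 u /\
  (forall k, D (w k)) /\
  is_lim_seq (fun k => l2_norm (seq_minus (w k) u)) 0 /\
  (forall eps : R, 0 < eps -> exists N : nat, forall k m : nat,
     (N <= k)%nat -> (N <= m)%nat -> Cmod (q (seq_minus (w k) (w m))) < eps).

Definition closure_dom (D : cseq -> Prop) (q : cseq -> C) (u : cseq) : Prop :=
  exists w, form_approx D q w u.

(* [iota P] is the unique element satisfying P. For a closable form the limit
   below does not depend on the approximating sequence. *)
Definition closure_val (D : cseq -> Prop) (q : cseq -> C) (u : cseq) : C :=
  iota (T := C_CompleteNormedModule) (fun l : C =>
    exists w, form_approx D q w u /\
      filterlim (fun k => q (w k)) eventually (locally (T := C_UniformSpace) l)).

Definition dom_t (alpha : R) : cseq -> Prop :=
  closure_dom (dom_H alpha) (H_form alpha).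

Definition form_t (alpha : R) : cseq -> C :=
  closure_val (dom_H alpha) (H_form alpha).

(* Main.v *)
Require Import Defs.
From Stdlib Require Import Reals Lra Lia Arith Classical FunctionalExtensionality.
From Coquelicot Require Import Coquelicot.
Open Scope R_scope.

(** The Laguerre operator factors as [A^* A], where [A = ladder alpha] sends
    [u] to [sqrt (n + alpha + 1) u_n - sqrt (n + 1) u_(n+1)]. The closed form
    is therefore expected to be [|A u|^2] on all [u] in l^2 with [A u] in l^2,
    and three facts make this precise.

    On the operator domain [<H u, u> = |A u|^2] ([H_form_energy]). Summation by
    parts leaves a boundary term of modulus
    [sqrt (n + 1) |A u|_n |u_(n+1)|]. If it stayed away from zero, the product
    of two square-summable sequences would dominate a multiple of
    [1 / sqrt (n + 1)], which is not summable ([weighted_product_small]); so its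
    limit is zero as soon as [A u] is in l^2. The same argument, with [|A u|_n]
    divided by the partial sums of [|A u|^2], shows first that [A u] is in l^2
    ([ladder_in_l2]).

    The operator [A] is closed, so an approximating sequence of [u] for the form
    has images converging to [A u] in l^2 ([form_approx_energy]). This bounds
    the domain of the closure from above and fixes the value of the form.

    Conversely, if [u] and [A u] are in l^2, then multiplying [u] by a piecewise
    linear cutoff of length [k] gives finitely supported sequences
    ([truncate_form_approx]). The commutator of [A] with the cutoff is of size
    [sqrt (n + 1) / k] on a range where [n] is of order [k], hence of operator
    norm of order [1 / sqrt k], and it tends to zero.

    Finally [A u] differs from [sqrt (n + 1) (u_n - u_(n+1))] by [u] times a
    bounded weight ([ladder_weighted_diff]), which gives a description of the
    domain in which [alpha] does not occur. *)

(** * Series of nonnegative real numbers *)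

Lemma sum_n_R_S (a : nat -> R) (n : nat) :
  sum_n a (S n) = sum_n a n + a (S n).
Proof. exact (sum_Sn a n). Qed.

Lemma sum_n_le_Series (a : nat -> R) (N : nat) :
  (forall n, 0 <= a n) -> ex_series a -> sum_n a N <= Series a.
Proof.
  intros Ha Hex.
  apply (is_lim_seq_incr_compare (sum_n a) (Series a)).
  - exact (Series_correct a Hex).
  - intros n. rewrite sum_n_R_S. specialize (Ha (S n)). lra.
Qed.

Lemma term_le_Series (a : nat -> R) (n : nat) :
  (forall m, 0 <= a m) -> ex_series a -> a n <= Series a.
Proof.
  intros Ha Hex.
  apply Rle_trans with (sum_n a n); [| now apply sum_n_le_Series].
  destruct n as [|n]; [rewrite sum_O; lra|].
  rewrite sum_n_R_S.
  assert (H : forall k, 0 <= sum_n a k).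
  { induction k; [rewrite sum_O; apply Ha|].
    rewrite sum_n_R_S; specialize (Ha (S k)); lra. }
  specialize (H n); lra.
Qed.

Lemma nonneg_series_bounded (a : nat -> R) (M : R) :
  (forall n, 0 <= a n) -> (forall N, sum_n a N <= M) ->
  ex_series a /\ Series a <= M.
Proof.
  intros Ha HM.
  destruct (ex_finite_lim_seq_incr (sum_n a) M) as [l Hl].
  - intros n. rewrite sum_n_R_S. specialize (Ha (S n)). lra.
  - exact HM.
  - assert (Hs : is_series a l) by exact Hl.
    split; [now exists l|].
    rewrite (is_series_unique _ _ Hs).
    apply (is_lim_seq_le (sum_n a) (fun _ => M) l M HM Hl).
    apply is_lim_seq_const.
Qed.

Lemma ex_series_dominated (a b : nat -> R) :
  (forall n, 0 <= a n <= b n) -> ex_series b -> ex_series a.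
Proof.
  intros H Hb.
  apply (ex_series_le (V := R_CompleteNormedModule) a b); [|exact Hb].
  intros n. destruct (H n).
  change (Rabs (a n) <= b n). rewrite Rabs_pos_eq; lra.
Qed.

Lemma ex_series_R_plus (a b : nat -> R) :
  ex_series a -> ex_series b -> ex_series (fun n => a n + b n).
Proof. apply (ex_series_plus (V := R_NormedModule)). Qed.

Lemma ex_series_R_scal (c : R) (a : nat -> R) :
  ex_series a -> ex_series (fun n => c * a n).
Proof. apply (ex_series_scal_l (V := R_NormedModule)). Qed.

Lemma ex_series_finite_support (a : nat -> R) (N : nat) :
  (forall n, (N <= n)%nat -> a n = 0) -> ex_series a.
Proof.
  intros H. apply (ex_series_incr_n a N).
  apply ex_series_ext with (fun _ => 0).
  - intros n. symmetry. apply H. lia.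
  - exists 0.
    assert (H0 : is_lim_seq (sum_n (fun _ : nat => 0)) 0).
    { apply (is_lim_seq_ext (fun _ => 0)).
      - intros n. induction n; [now rewrite sum_O|].
        rewrite sum_n_R_S, <- IHn. lra.
      - apply is_lim_seq_const. }
    exact H0.
Qed.

Lemma sum_n_plus_scal (a b : nat -> R) (c d : R) (N : nat) :
  sum_n (fun n => c * a n + d * b n) N = c * sum_n a N + d * sum_n b N.
Proof.
  induction N; [now rewrite !sum_O|].
  rewrite (sum_n_R_S a), (sum_n_R_S b), sum_n_R_S, IHN. lra.
Qed.

Lemma sum_n_R_le (a b : nat -> R) (N : nat) :
  (forall n, a n <= b n) -> sum_n a N <= sum_n b N.
Proof.
  intros H. induction N; [rewrite !sum_O; apply H|].
  rewrite !sum_n_R_S. specialize (H (S N)). lra.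
Qed.

Lemma sum_n_lim_0 (a : nat -> nat -> R) (N : nat) :
  (forall n, is_lim_seq (fun k => a k n) 0) ->
  is_lim_seq (fun k => sum_n (a k) N) 0.
Proof.
  intros H. induction N.
  - apply is_lim_seq_ext with (2 := H 0%nat). intros k. now rewrite sum_O.
  - apply is_lim_seq_ext with (fun k => sum_n (a k) N + a k (S N)).
    + intros k. now rewrite sum_n_R_S.
    + replace 0 with (0 + 0) by lra. now apply is_lim_seq_plus'.
Qed.

(** A family below a summable sequence whose supports move off to infinity has
    sums controlled by the tails of that sequence. *)
Lemma Series_escaping_lim_0 (f : nat -> R) (g : nat -> nat -> R) :
  ex_series f -> (forall k n, 0 <= g k n <= f n) ->
  (forall k n, (n <= k)%nat -> g k n = 0) ->
  is_lim_seq (fun k => Series (g k)) 0.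
Proof.
  intros Hf Hg Hz.
  assert (Hgk : forall k, ex_series (g k))
    by (intros k; now apply ex_series_dominated with f).
  apply is_lim_seq_le_le with (u := fun _ => 0)
    (w := fun k => Series f - sum_n f k).
  - intros k. split.
    + replace 0 with (Series (fun _ : nat => 0 * 0))
        by (rewrite Series_scal_l; lra).
      apply Series_le; [intros n; destruct (Hg k n); lra | apply Hgk].
    + assert (H : sum_n f k <= Series (fun n => f n - g k n)).
      { replace (sum_n f k) with (sum_n (fun n => f n - g k n) k).
        - apply sum_n_le_Series.
          + intros n. destruct (Hg k n). lra.
          + apply (ex_series_minus (V := R_NormedModule)); auto.
        - apply sum_n_ext_loc. intros n Hn. rewrite (Hz k n Hn). lra. }
      rewrite Series_minus in H; auto. lra.
  - apply is_lim_seq_const.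
  - replace 0 with (Series f - Series f) by lra.
    apply is_lim_seq_minus'; [apply is_lim_seq_const|].
    exact (Series_correct f Hf).
Qed.

Lemma sum_n_inv_sqrt_ge (N : nat) :
  sqrt (INR N + 1) <= sum_n (fun n => / sqrt (INR n + 1)) N.
Proof.
  induction N as [|N IH].
  - rewrite sum_O. simpl. rewrite Rplus_0_l, sqrt_1. lra.
  - rewrite sum_n_R_S, S_INR.
    set (x := INR N + 1) in *.
    assert (Hx : 1 <= x) by (unfold x; pose proof (pos_INR N); lra).
    apply Rle_trans with (sqrt x + / sqrt (x + 1)); [|lra].
    assert (H1 : 0 < sqrt (x + 1)) by (apply sqrt_lt_R0; lra).
    assert (H2 : sqrt x <= sqrt (x + 1)) by (apply sqrt_le_1; lra).
    assert (H3 : sqrt x * sqrt x = x) by (apply sqrt_sqrt; lra).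
    assert (H4 : sqrt (x + 1) * sqrt (x + 1) = x + 1) by (apply sqrt_sqrt; lra).
    assert (H0 : 0 <= sqrt x) by apply sqrt_pos.
    apply Rmult_le_reg_r with (sqrt (x + 1)); [exact H1|].
    rewrite Rmult_plus_distr_r, Rinv_l by lra. nra.
Qed.

Lemma inv_sqrt_not_summable : ~ ex_series (fun n => / sqrt (INR n + 1)).
Proof.
  intros H.
  destruct (INR_unbounded (Series (fun n => / sqrt (INR n + 1)) ^ 2)) as [N HN].
  assert (Hpos : forall n, 0 <= / sqrt (INR n + 1)).
  { intros n. left. apply Rinv_0_lt_compat, sqrt_lt_R0.
    pose proof (pos_INR n); lra. }
  pose proof (sum_n_le_Series _ N Hpos H) as H1.
  pose proof (sum_n_inv_sqrt_ge N) as H2.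
  pose proof (pos_INR N).
  assert (H3 : sqrt (INR N + 1) * sqrt (INR N + 1) = INR N + 1)
    by (apply sqrt_sqrt; lra).
  pose proof (sqrt_pos (INR N + 1)). nra.
Qed.

(** By the inequality of the means, a lower bound [c / sqrt (n + 1)] on
    [x n * y n] would make the series of [1 / sqrt (n + 1)] converge. *)
Lemma weighted_product_small (x y : nat -> R) (c : R) (N : nat) :
  ex_series (fun n => x n ^ 2) -> ex_series (fun n => y n ^ 2) -> 0 < c ->
  exists n, (N <= n)%nat /\ sqrt (INR n + 1) * (x n * y n) < c.
Proof.
  intros Hx Hy Hc. apply NNPP. intros Hno.
  apply inv_sqrt_not_summable.
  apply (ex_series_incr_n _ N).
  apply ex_series_dominated with
    (fun k => / c * (x (N + k)%nat ^ 2 + y (N + k)%nat ^ 2)).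
  - intros k. set (n := (N + k)%nat).
    assert (Hs : 0 < sqrt (INR n + 1))
      by (apply sqrt_lt_R0; pose proof (pos_INR n); lra).
    assert (Hge : c <= sqrt (INR n + 1) * (x n * y n)).
    { apply Rnot_lt_le. intros Hlt. apply Hno. exists n. split; [lia|exact Hlt]. }
    pose proof (Rinv_0_lt_compat _ Hs) as Hi.
    split; [lra|].
    apply Rmult_le_reg_l with c; [exact Hc|].
    rewrite <- Rmult_assoc, Rinv_r, Rmult_1_l by lra.
    apply Rle_trans with (x n * y n).
    + apply Rmult_le_reg_l with (sqrt (INR n + 1)); [exact Hs|].
      replace (sqrt (INR n + 1) * (c * / sqrt (INR n + 1))) with c
        by (field; lra).
      exact Hge.
    + pose proof (pow2_ge_0 (x n - y n)). nra.
  - apply ex_series_R_scal, ex_series_R_plus.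
    + now apply (ex_series_incr_n (fun n => x n ^ 2) N).
    + now apply (ex_series_incr_n (fun n => y n ^ 2) N).
Qed.

Lemma lim_0_of_weighted_product (f x y : nat -> R) (l : R) :
  ex_series (fun n => x n ^ 2) -> ex_series (fun n => y n ^ 2) ->
  (forall n, Rabs (f n) <= sqrt (INR n + 1) * (x n * y n)) ->
  is_lim_seq f l -> l = 0.
Proof.
  intros Hx Hy Hf Hl. apply NNPP. intros Hne.
  assert (Hc : 0 < Rabs l / 2) by (pose proof (Rabs_pos_lt l Hne); lra).
  destruct (proj2 (is_lim_seq_spec f l) Hl (mkposreal _ Hc)) as [N HN].
  destruct (weighted_product_small x y _ N Hx Hy Hc) as (n & Hn & Hlt).
  specialize (HN n Hn). simpl in HN. specialize (Hf n).
  pose proof (Rabs_triang_inv l (f n)) as Ht.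
  rewrite Rabs_minus_sym in Ht. lra.
Qed.

(** With [T n = 1 + sum_n a n], the terms are at most [1 / T (n-1) - 1 / T n],
    so the sum telescopes even when [sum_n a] diverges. *)
Lemma ex_series_div_partial_sum_sq (a : nat -> R) :
  (forall n, 0 <= a n) -> ex_series (fun n => a n / (1 + sum_n a n) ^ 2).
Proof.
  intros Ha.
  assert (HS : forall n, 0 <= sum_n a n).
  { induction n; [rewrite sum_O; apply Ha|].
    rewrite sum_n_R_S; specialize (Ha (S n)); lra. }
  apply (nonneg_series_bounded _ 1).
  - intros n. specialize (Ha n). specialize (HS n).
    apply Rmult_le_pos; [exact Ha|]. left. apply Rinv_0_lt_compat. nra.
  - assert (H : forall s b, 0 <= s -> 0 <= b ->
      b / (1 + (s + b)) ^ 2 <= / (1 + s) - / (1 + (s + b))).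
    { intros s b Hs Hb.
      replace (/ (1 + s) - / (1 + (s + b)))
        with (b / ((1 + s) * (1 + (s + b)))) by (field; lra).
      apply Rmult_le_compat_l; [exact Hb|].
      apply Rinv_le_contravar; nra. }
    assert (Hb : forall N, sum_n (fun n => a n / (1 + sum_n a n) ^ 2) N
                           <= 1 - / (1 + sum_n a N)).
    { induction N as [|N IH].
      - rewrite !sum_O. pose proof (H 0 (a 0%nat) (Rle_refl 0) (Ha 0%nat)) as H0.
        rewrite Rplus_0_l, Rplus_0_r, Rinv_1 in H0. exact H0.
      - rewrite sum_n_R_S, (sum_n_R_S a N).
        pose proof (H (sum_n a N) (a (S N)) (HS N) (Ha (S N))). lra. }
    intros N. specialize (Hb N). specialize (HS N).
    assert (0 < / (1 + sum_n a N)) by (apply Rinv_0_lt_compat; lra). lra.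
Qed.

(** * Square-summable complex sequences *)

Definition l2_sq (u : cseq) : R := Series (fun n => Cmod (u n) ^ 2).

Lemma Cmod_sq_nonneg (z : C) : 0 <= Cmod z ^ 2.
Proof. apply pow2_ge_0. Qed.

Lemma im_le_Cmod (z : C) : Rabs (Im z) <= Cmod z.
Proof.
  pose proof (Cmod2_alt z). pose proof (Cmod_ge_0 z).
  pose proof (pow2_ge_0 (Re z)). apply Rabs_le. split; nra.
Qed.

Lemma Cmod_sq_plus_le (z w : C) :
  Cmod (z + w) ^ 2 <= 2 * Cmod z ^ 2 + 2 * Cmod w ^ 2.
Proof.
  rewrite !Cmod2_alt. destruct z as [a b], w as [c d]; simpl.
  pose proof (pow2_ge_0 (a - c)). pose proof (pow2_ge_0 (b - d)). nra.
Qed.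

Lemma Cmod_sq_minus_le (z w : C) :
  Cmod (z - w) ^ 2 <= 2 * Cmod z ^ 2 + 2 * Cmod w ^ 2.
Proof.
  replace (Cmod w) with (Cmod (- w)) by apply Cmod_opp.
  apply Cmod_sq_plus_le.
Qed.

Lemma Cmod_sq_minus_triangle (z w t : C) :
  Cmod (z - t) ^ 2 <= 2 * Cmod (z - w) ^ 2 + 2 * Cmod (w - t) ^ 2.
Proof.
  replace (z - t)%C with ((z - w) + (w - t))%C by ring.
  apply Cmod_sq_plus_le.
Qed.

(** Young's inequality for the cross term of [|b|^2 = |a + (b - a)|^2]. *)
Lemma Cmod_sq_perturb (a b : C) (d : R) : 0 < d ->
  Rabs (Cmod b ^ 2 - Cmod a ^ 2)
  <= d * Cmod a ^ 2 + (1 + / d) * Cmod (b - a) ^ 2.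
Proof.
  intros Hd. rewrite !Cmod2_alt.
  destruct a as [a1 a2], b as [b1 b2]; simpl.
  assert (Hc : forall x y, Rabs (2 * x * y) <= d * x ^ 2 + / d * y ^ 2).
  { intros x y.
    assert (H : forall t, 2 * x * t <= d * x ^ 2 + / d * t ^ 2).
    { intros t.
      replace (d * x ^ 2 + / d * t ^ 2)
        with (2 * x * t + / d * (d * x - t) ^ 2) by (field; lra).
      pose proof (pow2_ge_0 (d * x - t)).
      pose proof (Rinv_0_lt_compat d Hd). nra. }
    apply Rabs_le. pose proof (H y). pose proof (H (- y)). simpl in *. lra. }
  pose proof (Hc a1 (b1 - a1)) as H1. pose proof (Hc a2 (b2 - a2)) as H2.
  apply Rabs_le_between in H1. apply Rabs_le_between in H2.
  pose proof (pow2_ge_0 (b1 - a1)). pose proof (pow2_ge_0 (b2 - a2)).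
  apply Rabs_le. simpl in *. lra.
Qed.

Lemma l2_sq_nonneg (u : cseq) : in_l2 u -> 0 <= l2_sq u.
Proof.
  intros Hu.
  apply Rle_trans with (Cmod (u 0%nat) ^ 2); [apply Cmod_sq_nonneg|].
  apply (term_le_Series (fun n => Cmod (u n) ^ 2));
    [intros; apply Cmod_sq_nonneg | exact Hu].
Qed.

Lemma Cmod_sq_le_l2_sq (u : cseq) (n : nat) : in_l2 u -> Cmod (u n) ^ 2 <= l2_sq u.
Proof.
  intros Hu.
  apply (term_le_Series (fun m => Cmod (u m) ^ 2));
    [intros; apply Cmod_sq_nonneg | exact Hu].
Qed.

Lemma l2_bound2 (u v w : cseq) :
  in_l2 v -> in_l2 w ->
  (forall n, Cmod (u n) ^ 2 <= 2 * Cmod (v n) ^ 2 + 2 * Cmod (w n) ^ 2) ->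
  in_l2 u /\ l2_sq u <= 2 * l2_sq v + 2 * l2_sq w.
Proof.
  intros Hv Hw H.
  assert (Hex : ex_series (fun n => 2 * Cmod (v n) ^ 2 + 2 * Cmod (w n) ^ 2))
    by (apply ex_series_R_plus; apply ex_series_R_scal; assumption).
  assert (Hb : forall n, 0 <= Cmod (u n) ^ 2
               <= 2 * Cmod (v n) ^ 2 + 2 * Cmod (w n) ^ 2)
    by (intros n; split; [apply Cmod_sq_nonneg | apply H]).
  split; [now apply ex_series_dominated with (1 := Hb)|].
  unfold l2_sq. rewrite <- !Series_scal_l, <- Series_plus
    by (apply ex_series_R_scal; assumption).
  now apply Series_le.
Qed.

Lemma l2_minus (u v : cseq) :
  in_l2 u -> in_l2 v -> in_l2 (seq_minus u v).
Proof.
  intros Hu Hv. apply (l2_bound2 _ u v Hu Hv).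
  intros n. apply Cmod_sq_minus_le.
Qed.

Lemma l2_finite_support (u : cseq) (N : nat) :
  (forall n, (N <= n)%nat -> u n = RtoC 0) -> in_l2 u.
Proof.
  intros H. apply ex_series_finite_support with N.
  intros n Hn. rewrite (H n Hn), Cmod_0. ring.
Qed.

Lemma l2_norm_lim_0 (v : nat -> cseq) :
  (forall k, in_l2 (v k)) ->
  is_lim_seq (fun k => l2_norm (v k)) 0 <-> is_lim_seq (fun k => l2_sq (v k)) 0.
Proof.
  intros Hv. split; intros H.
  - apply is_lim_seq_ext with (fun k => l2_norm (v k) * l2_norm (v k)).
    + intros k. apply sqrt_sqrt. now apply l2_sq_nonneg.
    + replace 0 with (0 * 0) by lra. now apply is_lim_seq_mult'.
  - replace 0 with (sqrt 0) by apply sqrt_0.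
    apply (is_lim_seq_continuous sqrt (fun k => l2_sq (v k)) 0); [|exact H].
    apply continuity_pt_sqrt. lra.
Qed.

Lemma l2_sq_continuous (b : nat -> cseq) (a : cseq) :
  in_l2 a -> (forall k, in_l2 (b k)) ->
  is_lim_seq (fun k => l2_sq (seq_minus (b k) a)) 0 ->
  is_lim_seq (fun k => l2_sq (b k)) (l2_sq a).
Proof.
  intros Ha Hb Hl.
  assert (Hpert : forall d k, 0 < d -> Rabs (l2_sq (b k) - l2_sq a)
            <= d * l2_sq a + (1 + / d) * l2_sq (seq_minus (b k) a)).
  { intros d k Hd.
    pose proof (l2_minus _ _ (Hb k) Ha) as Hm.
    assert (Hex : ex_series (fun n => d * Cmod (a n) ^ 2
                     + (1 + / d) * Cmod (seq_minus (b k) a n) ^ 2))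
      by (apply ex_series_R_plus; apply ex_series_R_scal; assumption).
    unfold l2_sq. rewrite <- !Series_scal_l, <- Series_plus, <- Series_minus
      by (first [exact (Hb k) | assumption | apply ex_series_R_scal; assumption]).
    assert (Hp : forall n, 0 <= Rabs (Cmod (b k n) ^ 2 - Cmod (a n) ^ 2)
       <= d * Cmod (a n) ^ 2 + (1 + / d) * Cmod (seq_minus (b k) a n) ^ 2)
      by (intros n; split; [apply Rabs_pos | now apply Cmod_sq_perturb]).
    eapply Rle_trans; [apply Series_Rabs|].
    - now apply ex_series_dominated with (1 := Hp).
    - now apply Series_le. }
  pose proof (l2_sq_nonneg a Ha) as HA. set (A := l2_sq a) in *.
  apply is_lim_seq_spec. intros eps. destruct eps as [eps He]. simpl.
  set (d := eps / (2 * (A + 1))).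
  assert (Hd : 0 < d) by (apply Rdiv_lt_0_compat; lra).
  pose proof (Rinv_0_lt_compat d Hd) as Hd'.
  assert (HdA : d * A < eps / 2).
  { replace (eps / 2) with (d * (A + 1)) by (unfold d; field; lra). nra. }
  assert (Hc : 0 < eps / 2 / (1 + / d)) by (apply Rdiv_lt_0_compat; lra).
  destruct (proj2 (is_lim_seq_spec _ 0) Hl (mkposreal _ Hc)) as [N HN].
  exists N. intros k Hk. specialize (HN k Hk). simpl in HN.
  rewrite Rminus_0_r in HN. apply Rabs_lt_between in HN.
  specialize (Hpert d k Hd).
  assert ((1 + / d) * l2_sq (seq_minus (b k) a) < eps / 2).
  { replace (eps / 2) with ((1 + / d) * (eps / 2 / (1 + / d))) by (field; split; lra).
    apply Rmult_lt_compat_l; lra. }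
  lra.
Qed.

(** Completeness of the space in a form that identifies the limit: the tails
    of a Cauchy sequence are compared, on finitely many coordinates at a time,
    with its coordinatewise limit. *)
Lemma l2_cauchy_pointwise (b : nat -> cseq) (a : cseq) :
  (forall k, in_l2 (b k)) ->
  (forall eps, 0 < eps -> exists N, forall k m, (N <= k)%nat -> (N <= m)%nat ->
     l2_sq (seq_minus (b k) (b m)) < eps) ->
  (forall n, is_lim_seq (fun k => Cmod (b k n - a n) ^ 2) 0) ->
  in_l2 a /\ is_lim_seq (fun k => l2_sq (seq_minus (b k) a)) 0.
Proof.
  intros Hb Hc Hp.
  assert (Htail : forall eps, 0 < eps -> exists N, forall k, (N <= k)%nat ->
     in_l2 (seq_minus (b k) a) /\ l2_sq (seq_minus (b k) a) <= 2 * eps).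
  { intros eps He. destruct (Hc eps He) as [N HN]. exists N. intros k Hk.
    apply nonneg_series_bounded; [intros; apply Cmod_sq_nonneg|].
    intros M.
    assert (Hlim : is_lim_seq (fun m => 2 * eps
        + 2 * sum_n (fun n => Cmod (b (N + m)%nat n - a n) ^ 2) M) (2 * eps)).
    { replace (Finite (2 * eps)) with (Finite (2 * eps + 2 * 0))
        by (f_equal; lra).
      apply is_lim_seq_plus'; [apply is_lim_seq_const|].
      apply is_lim_seq_mult'; [apply is_lim_seq_const|].
      apply (sum_n_lim_0 (fun m n => Cmod (b (N + m)%nat n - a n) ^ 2)).
      intros n.
      apply is_lim_seq_ext with (fun m => Cmod (b (m + N)%nat n - a n) ^ 2).
      - intros m. now rewrite Nat.add_comm.
      - apply (is_lim_seq_incr_n (fun m => Cmod (b m n - a n) ^ 2) N 0), Hp. }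
    refine (is_lim_seq_le (fun _ => _) _ _ _ _ (is_lim_seq_const _) Hlim).
    intros m.
    apply Rle_trans with (sum_n (fun n =>
      2 * Cmod (b k n - b (N + m)%nat n) ^ 2
      + 2 * Cmod (b (N + m)%nat n - a n) ^ 2) M).
    - apply sum_n_R_le. intros n. apply Cmod_sq_minus_triangle.
    - rewrite (sum_n_plus_scal (fun n => Cmod (b k n - b (N + m)%nat n) ^ 2)
                 (fun n => Cmod (b (N + m)%nat n - a n) ^ 2)).
      assert (sum_n (fun n => Cmod (b k n - b (N + m)%nat n) ^ 2) M <= eps).
      { apply Rle_trans with (l2_sq (seq_minus (b k) (b (N + m)%nat))).
        - apply (sum_n_le_Series
            (fun n => Cmod (seq_minus (b k) (b (N + m)%nat) n) ^ 2));
            [intros; apply Cmod_sq_nonneg | now apply l2_minus].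
        - left. apply HN; lia. }
      lra. }
  assert (Ha : in_l2 a).
  { destruct (Htail 1 Rlt_0_1) as [N HN]. destruct (HN N (le_n N)) as [H _].
    apply (l2_bound2 a (b N) (seq_minus (b N) a) (Hb N) H).
    intros n. replace (a n) with (b N n - seq_minus (b N) a n)%C at 1
      by (unfold seq_minus; ring).
    apply Cmod_sq_minus_le. }
  split; [exact Ha|].
  apply is_lim_seq_spec. intros [eps He]. simpl.
  destruct (Htail (eps / 4)) as [N HN]; [lra|].
  exists N. intros k Hk. destruct (HN k Hk) as [H1 H2].
  pose proof (l2_sq_nonneg _ H1). rewrite Rminus_0_r, Rabs_pos_eq; lra.
Qed.

(** * The factorization of the Laguerre operator *)

Definition ladder (alpha : R) (u : cseq) : cseq := fun n =>
  Cminus (Cmult (RtoC (sqrt (INR n + alpha + 1))) (u n))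
         (Cmult (RtoC (sqrt (INR n + 1))) (u (S n))).

Lemma ladder_seq_minus (alpha : R) (u v : cseq) :
  ladder alpha (seq_minus u v) = seq_minus (ladder alpha u) (ladder alpha v).
Proof.
  apply functional_extensionality. intros n. unfold ladder, seq_minus. ring.
Qed.

Lemma tau_seq_minus (alpha : R) (u v : cseq) :
  tau alpha (seq_minus u v) = seq_minus (tau alpha u) (tau alpha v).
Proof.
  apply functional_extensionality. intros [|n];
    unfold tau, seq_minus, shift; ring.
Qed.

Lemma dom_H_seq_minus (alpha : R) (u v : cseq) :
  dom_H alpha u -> dom_H alpha v -> dom_H alpha (seq_minus u v).
Proof.
  intros [Hu Htu] [Hv Htv]. split; [now apply l2_minus|].
  rewrite tau_seq_minus. now apply l2_minus.
Qed.

(** The right-hand side is [A^* A u], where [A] is [ladder alpha]. *)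
Lemma tau_ladder (alpha : R) (u : cseq) (n : nat) : -1 < alpha ->
  tau alpha u n =
  (RtoC (sqrt (INR n + alpha + 1)) * ladder alpha u n
   - RtoC (sqrt (INR n)) * shift (ladder alpha u) n)%C.
Proof.
  intros Ha. pose proof (pos_INR n) as Hn.
  assert (Hs : sqrt ((INR n + 1) * (INR n + 1 + alpha))
               = sqrt (INR n + alpha + 1) * sqrt (INR n + 1)).
  { rewrite <- sqrt_mult by lra. f_equal. ring. }
  assert (Hd : RtoC (INR n + alpha + 1) =
    (RtoC (sqrt (INR n + alpha + 1)) * RtoC (sqrt (INR n + alpha + 1)))%C)
    by (rewrite <- RtoC_mult, sqrt_sqrt by lra; reflexivity).
  unfold tau. rewrite Hs.
  replace (2 * INR n + 1 + alpha) with ((INR n + alpha + 1) + INR n) by ring.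
  rewrite RtoC_mult, RtoC_plus, Hd.
  destruct n as [|n].
  - unfold shift, ladder. simpl (INR 0). rewrite !Rmult_0_l, sqrt_0. ring.
  - pose proof (pos_INR n) as Hn'.
    assert (He : RtoC (INR (S n)) =
      (RtoC (sqrt (INR (S n))) * RtoC (sqrt (INR (S n))))%C)
      by (rewrite <- RtoC_mult, sqrt_sqrt by lra; reflexivity).
    assert (Hs' : sqrt (INR (S n) * (INR (S n) + alpha))
                  = sqrt (INR (S n)) * sqrt (INR n + alpha + 1)).
    { rewrite sqrt_mult by (rewrite ?S_INR in *; lra). do 2 f_equal.
      rewrite S_INR. ring. }
    rewrite He, Hs'. unfold shift, ladder. rewrite RtoC_mult.
    replace (INR n + 1) with (INR (S n)) by apply S_INR. ring.
Qed.

(** The boundary term of the summation by parts in [<A^* A u, u> = |A u|^2]. *)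
Definition boundary (alpha : R) (u : cseq) (n : nat) : C :=
  (RtoC (sqrt (INR n + 1)) * ladder alpha u n * Cconj (u (S n)))%C.

Lemma Cmod_boundary (alpha : R) (u : cseq) (n : nat) :
  Cmod (boundary alpha u n)
  = sqrt (INR n + 1) * (Cmod (ladder alpha u n) * Cmod (u (S n))).
Proof.
  unfold boundary. rewrite !Cmod_mult, Cmod_conj, Cmod_R, Rabs_pos_eq.
  - ring.
  - apply sqrt_pos.
Qed.

Lemma ladder_inner_term (alpha : R) (u : cseq) (n : nat) :
  (RtoC (sqrt (INR n + alpha + 1)) * ladder alpha u n * Cconj (u n))%C
  = (RtoC (Cmod (ladder alpha u n) ^ 2) + boundary alpha u n)%C.
Proof.
  rewrite Cmod2_alt. unfold boundary, ladder.
  destruct (u n) as [a b], (u (S n)) as [c d].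
  apply injective_projections; simpl; ring.
Qed.

Lemma green_partial_sums (alpha : R) (u : cseq) (N : nat) : -1 < alpha ->
  sum_n (fun n => Re (tau alpha u n * Cconj (u n))) N
    = sum_n (fun n => Cmod (ladder alpha u n) ^ 2) N + Re (boundary alpha u N) /\
  sum_n (fun n => Im (tau alpha u n * Cconj (u n))) N = Im (boundary alpha u N).
Proof.
  intros Ha.
  assert (H0 : (tau alpha u 0%nat * Cconj (u 0%nat))%C
    = (RtoC (Cmod (ladder alpha u 0%nat) ^ 2) + boundary alpha u 0%nat)%C).
  { rewrite tau_ladder, <- ladder_inner_term by exact Ha. unfold shift. ring. }
  assert (HS : forall n, (tau alpha u (S n) * Cconj (u (S n)))%C
    = (RtoC (Cmod (ladder alpha u (S n)) ^ 2) + boundary alpha u (S n)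
       - boundary alpha u n)%C).
  { intros n.
    rewrite tau_ladder, <- ladder_inner_term by exact Ha.
    unfold boundary, shift. rewrite (S_INR n). ring. }
  induction N as [|N [IH1 IH2]].
  - rewrite !sum_O, H0. simpl. split; ring.
  - rewrite !sum_n_R_S, IH1, IH2, HS. simpl. split; lra.
Qed.

Lemma inner_summable (f u : cseq) :
  in_l2 f -> in_l2 u ->
  ex_series (fun n => Re (f n * Cconj (u n))) /\
  ex_series (fun n => Im (f n * Cconj (u n))).
Proof.
  intros Hf Hu.
  assert (Hex : ex_series (fun n => / 2 * (Cmod (f n) ^ 2 + Cmod (u n) ^ 2)))
    by (now apply ex_series_R_scal, ex_series_R_plus).
  assert (Hb : forall n, Cmod (f n * Cconj (u n))
            <= / 2 * (Cmod (f n) ^ 2 + Cmod (u n) ^ 2)).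
  { intros n. rewrite Cmod_mult, Cmod_conj.
    pose proof (pow2_ge_0 (Cmod (f n) - Cmod (u n))). nra. }
  split; apply ex_series_Rabs; apply ex_series_dominated with (2 := Hex);
    intros n; (split; [apply Rabs_pos|]);
    (eapply Rle_trans; [|apply Hb]).
  - apply re_le_Cmod.
  - apply im_le_Cmod.
Qed.

(** If the partial sums [S n] of [|A u|^2] were unbounded, the boundary term
    would have to exceed [(1 + S n) / 2] eventually, although
    [|A u|_n / (1 + S n)] and [u] are both square-summable. *)
Lemma ladder_in_l2 (alpha : R) (u : cseq) : -1 < alpha ->
  dom_H alpha u -> in_l2 (ladder alpha u).
Proof.
  intros Ha [Hu Htu].
  destruct (inner_summable _ _ Htu Hu) as [[p Hp] _].
  set (a := fun n => Cmod (ladder alpha u n) ^ 2).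
  assert (Han : forall n, 0 <= a n) by (intros n; apply Cmod_sq_nonneg).
  apply NNPP. intros Hno.
  destruct (filterlim_bounded
    (K := R_AbsRing) (V := R_NormedModule)
    (sum_n (fun n => Re (tau alpha u n * Cconj (u n)))) (ex_intro _ p Hp))
    as [K HK].
  change (forall n, Rabs (sum_n (fun n => Re (tau alpha u n * Cconj (u n))) n)
    <= K) in HK.
  (* Beyond [2 K + 1], [S n - K] is at least [(1 + S n) / 2]. *)
  assert (Hbig : exists N, 2 * K + 1 < sum_n a N).
  { apply NNPP. intros Hb. apply Hno.
    apply (nonneg_series_bounded a (2 * K + 1) Han).
    intros N. apply Rnot_lt_le. intros Hlt. apply Hb. now exists N. }
  destruct Hbig as [N HN].
  assert (HS : forall n, (N <= n)%nat -> 2 * K + 1 < sum_n a n).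
  { intros n Hn. induction Hn as [|n Hn IH]; [exact HN|].
    rewrite sum_n_R_S. specialize (Han (S n)). lra. }
  assert (Hx : ex_series (fun n =>
            (Cmod (ladder alpha u n) / (1 + sum_n a n)) ^ 2)).
  { apply ex_series_ext with (2 := ex_series_div_partial_sum_sq a Han).
    intros n. unfold a at 1, Rdiv. now rewrite Rpow_mult_distr, pow_inv. }
  destruct (weighted_product_small _ (fun n => Cmod (u (S n))) (/ 2) N Hx)
    as (n & Hn & Hlt).
  - now apply (ex_series_incr_1 (fun n => Cmod (u n) ^ 2)).
  - lra.
  - specialize (HS n Hn). specialize (HK n).
    rewrite (proj1 (green_partial_sums alpha u n Ha)) in HK. fold a in HK.
    pose proof (re_le_Cmod (boundary alpha u n)) as Hre.
    rewrite Cmod_boundary in Hre.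
    apply Rabs_le_between in HK. apply Rabs_le_between in Hre.
    assert (HKpos : 0 <= K) by lra.
    set (B := sqrt (INR n + 1) * (Cmod (ladder alpha u n) * Cmod (u (S n)))) in *.
    replace (sqrt (INR n + 1) * (Cmod (ladder alpha u n) / (1 + sum_n a n)
               * Cmod (u (S n)))) with (B / (1 + sum_n a n)) in Hlt
      by (unfold B; field; lra).
    apply Rmult_lt_compat_r with (r := 1 + sum_n a n) in Hlt; [|lra].
    unfold Rdiv in Hlt. rewrite Rmult_assoc, Rinv_l in Hlt by lra. lra.
Qed.

Lemma H_form_energy (alpha : R) (u : cseq) : -1 < alpha ->
  dom_H alpha u -> H_form alpha u = RtoC (l2_sq (ladder alpha u)).
Proof.
  intros Ha HD. pose proof (ladder_in_l2 alpha u Ha HD) as Hv.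
  destruct HD as [Hu Htu].
  destruct (inner_summable _ _ Htu Hu) as [Hre Him].
  pose proof (proj1 (ex_series_incr_1 (fun n => Cmod (u n) ^ 2)) Hu) as HuS.
  assert (Hreal : Series (fun n => Re (tau alpha u n * Cconj (u n)))
                  - l2_sq (ladder alpha u) = 0).
  { apply (lim_0_of_weighted_product (fun n => Re (boundary alpha u n))
      (fun n => Cmod (ladder alpha u n)) (fun n => Cmod (u (S n))));
      [exact Hv | exact HuS | |].
    - intros n. rewrite <- Cmod_boundary. apply re_le_Cmod.
    - apply is_lim_seq_ext with (fun N =>
        sum_n (fun n => Re (tau alpha u n * Cconj (u n))) N
        - sum_n (fun n => Cmod (ladder alpha u n) ^ 2) N).
      + intros N. rewrite (proj1 (green_partial_sums alpha u N Ha)). lra.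
      + apply is_lim_seq_minus';
          [exact (Series_correct _ Hre) | exact (Series_correct _ Hv)]. }
  assert (Himag : Series (fun n => Im (tau alpha u n * Cconj (u n))) = 0).
  { apply (lim_0_of_weighted_product (fun n => Im (boundary alpha u n))
      (fun n => Cmod (ladder alpha u n)) (fun n => Cmod (u (S n))));
      [exact Hv | exact HuS | |].
    - intros n. rewrite <- Cmod_boundary. apply im_le_Cmod.
    - apply is_lim_seq_ext with (2 := Series_correct _ Him).
      intros N. apply (green_partial_sums alpha u N Ha). }
  unfold H_form, l2_inner, CSeries, RtoC. f_equal; [lra | exact Himag].
Qed.

(** * The closure of the form *)

(** Closedness of the ladder operator: along an approximating sequence the
    images are Cauchy by [H_form_energy], and they converge coordinatewise since
    each coordinate of the image involves only two coordinates of the argument. *)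
Lemma form_approx_energy (alpha : R) (w : nat -> cseq) (u : cseq) :
  -1 < alpha -> form_approx (dom_H alpha) (H_form alpha) w u ->
  in_l2 (ladder alpha u) /\
  is_lim_seq (fun k => l2_sq (ladder alpha (w k))) (l2_sq (ladder alpha u)).
Proof.
  intros Ha (Hu & Hw & Hlim & Hc).
  assert (Hwu : forall k, in_l2 (seq_minus (w k) u))
    by (intros k; apply l2_minus; [apply Hw | exact Hu]).
  apply (l2_norm_lim_0 _ Hwu) in Hlim.
  assert (Hlw : forall k, in_l2 (ladder alpha (w k)))
    by (intros k; now apply ladder_in_l2).
  destruct (l2_cauchy_pointwise (fun k => ladder alpha (w k)) (ladder alpha u))
    as [Hl Hl']; [exact Hlw | | | ].
  - intros eps He. destruct (Hc eps He) as [N HN]. exists N. intros k m Hk Hm.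
    specialize (HN k m Hk Hm).
    rewrite H_form_energy in HN by (auto using dom_H_seq_minus).
    rewrite Cmod_R, ladder_seq_minus in HN.
    eapply Rle_lt_trans; [apply Rle_abs | exact HN].
  - intros n.
    set (c := 2 * Rabs (sqrt (INR n + alpha + 1)) ^ 2
              + 2 * Rabs (sqrt (INR n + 1)) ^ 2).
    apply is_lim_seq_le_le with (u := fun _ => 0)
      (w := fun k => c * l2_sq (seq_minus (w k) u)).
    + intros k. split; [apply Cmod_sq_nonneg|].
      change (ladder alpha (w k) n - ladder alpha u n)%C
        with (seq_minus (ladder alpha (w k)) (ladder alpha u) n).
      rewrite <- ladder_seq_minus. unfold ladder at 1.
      eapply Rle_trans; [apply Cmod_sq_minus_le|].
      rewrite !Cmod_mult, !Cmod_R, !Rpow_mult_distr.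
      pose proof (Cmod_sq_le_l2_sq _ n (Hwu k)).
      pose proof (Cmod_sq_le_l2_sq _ (S n) (Hwu k)).
      pose proof (pow2_ge_0 (Rabs (sqrt (INR n + alpha + 1)))).
      pose proof (pow2_ge_0 (Rabs (sqrt (INR n + 1)))).
      unfold c. nra.
    + apply is_lim_seq_const.
    + replace (Finite 0) with (Finite (c * 0)) by (f_equal; lra).
      apply is_lim_seq_mult'; [apply is_lim_seq_const | exact Hlim].
  - split; [exact Hl|]. now apply l2_sq_continuous.
Qed.

(** The plateau up to [k] turns the remainder [1 - cutoff k] into a tail; the
    slope [1 / (k + 1)] keeps the commutator with the ladder operator small. *)
Definition cutoff (k n : nat) : R :=
  Rmax 0 (Rmin 1 (2 - INR n / (INR k + 1))).

Definition truncate (k : nat) (u : cseq) : cseq :=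
  fun n => (RtoC (cutoff k n) * u n)%C.

Lemma cutoff_bounds (k n : nat) : 0 <= cutoff k n <= 1.
Proof.
  unfold cutoff. split; [apply Rmax_l|].
  apply Rmax_lub; [lra | apply Rmin_l].
Qed.

Lemma cutoff_one (k n : nat) : (n <= k)%nat -> cutoff k n = 1.
Proof.
  intros H. apply le_INR in H. pose proof (pos_INR k).
  assert (INR n / (INR k + 1) <= 1).
  { apply Rmult_le_reg_r with (INR k + 1); [lra|].
    unfold Rdiv. rewrite Rmult_assoc, Rinv_l by lra. lra. }
  unfold cutoff. rewrite Rmin_left, Rmax_right; lra.
Qed.

Lemma cutoff_zero (k n : nat) : (2 * (k + 1) <= n)%nat -> cutoff k n = 0.
Proof.
  intros H. apply le_INR in H. pose proof (pos_INR k).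
  rewrite mult_INR, plus_INR in H. simpl in H.
  assert (2 <= INR n / (INR k + 1)).
  { apply Rmult_le_reg_r with (INR k + 1); [lra|].
    unfold Rdiv. rewrite Rmult_assoc, Rinv_l by lra. lra. }
  unfold cutoff. rewrite Rmin_right, Rmax_left; lra.
Qed.

Lemma cutoff_lipschitz (k n : nat) :
  Rabs (cutoff k n - cutoff k (S n)) <= / (INR k + 1).
Proof.
  unfold cutoff. rewrite S_INR. pose proof (pos_INR k).
  pose proof (Rinv_0_lt_compat (INR k + 1) ltac:(lra)).
  replace ((INR n + 1) / (INR k + 1)) with (INR n / (INR k + 1) + / (INR k + 1))
    by (field; lra).
  unfold Rmax, Rmin.
  apply Rabs_le.
  repeat destruct Rle_dec; lra.
Qed.

(** The cutoff decreases with slope [1 / (k + 1)] and is constant beyond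
    [2 (k + 1)], so the weight [n + 1] of the commutator costs only [2 (k + 1)]. *)
Lemma cutoff_gradient (k n : nat) :
  (INR n + 1) * (cutoff k n - cutoff k (S n)) ^ 2 <= 2 / (INR k + 1).
Proof.
  pose proof (pos_INR k). pose proof (pos_INR n).
  pose proof (Rinv_0_lt_compat (INR k + 1) ltac:(lra)) as Hi.
  destruct (le_lt_dec (2 * (k + 1)) n) as [Hn|Hn].
  - rewrite !cutoff_zero by lia. unfold Rdiv. nra.
  - assert (Hn' : INR n + 1 <= 2 * (INR k + 1)).
    { apply le_INR in Hn. rewrite S_INR, mult_INR, plus_INR in Hn.
      simpl in Hn. lra. }
    assert (Hsq : (cutoff k n - cutoff k (S n)) ^ 2 <= (/ (INR k + 1)) ^ 2).
    { rewrite <- (pow2_abs (cutoff k n - cutoff k (S n))).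
      apply pow_incr. split; [apply Rabs_pos | apply cutoff_lipschitz]. }
    replace (2 / (INR k + 1)) with (2 * (INR k + 1) * (/ (INR k + 1)) ^ 2)
      by (field; lra).
    apply Rmult_le_compat; [lra | apply pow2_ge_0 | exact Hn' | exact Hsq].
Qed.

Lemma truncate_dom_H (alpha : R) (k : nat) (u : cseq) : dom_H alpha (truncate k u).
Proof.
  assert (Hz : forall n, (2 * (k + 1) <= n)%nat -> truncate k u n = RtoC 0)
    by (intros n Hn; unfold truncate; rewrite cutoff_zero by exact Hn; ring).
  split; [now apply l2_finite_support with (1 := Hz)|].
  apply l2_finite_support with (S (2 * (k + 1))).
  intros [|n] Hn; [lia|]. unfold tau, shift.
  rewrite !Hz by lia. ring.
Qed.

Lemma plateau_remainder_lim_0 (u : cseq) : in_l2 u ->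
  is_lim_seq (fun k => Series (fun n => (1 - cutoff k n) ^ 2 * Cmod (u n) ^ 2)) 0.
Proof.
  intros Hu. apply (Series_escaping_lim_0 _ _ Hu).
  - intros k n. pose proof (cutoff_bounds k n). pose proof (Cmod_sq_nonneg (u n)).
    assert (0 <= (1 - cutoff k n) ^ 2 <= 1) by nra. nra.
  - intros k n Hn. rewrite (cutoff_one k n Hn). ring.
Qed.

Lemma truncate_lim (u : cseq) : in_l2 u ->
  is_lim_seq (fun k => l2_sq (seq_minus (truncate k u) u)) 0.
Proof.
  intros Hu.
  apply is_lim_seq_ext with (2 := plateau_remainder_lim_0 u Hu).
  intros k. apply Series_ext. intros n. unfold seq_minus, truncate.
  replace (RtoC (cutoff k n) * u n - u n)%C with (RtoC (cutoff k n - 1) * u n)%C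
    by (rewrite RtoC_minus; ring).
  rewrite Cmod_mult, Cmod_R, Rpow_mult_distr, pow2_abs. ring.
Qed.

(** [A (chi u) - A u = (chi - 1) A u + [A, chi] u], where the commutator with
    the cutoff is controlled by [cutoff_gradient]. *)
Lemma ladder_truncate_lim (alpha : R) (u : cseq) :
  in_l2 u -> in_l2 (ladder alpha u) ->
  is_lim_seq (fun k =>
    l2_sq (seq_minus (ladder alpha (truncate k u)) (ladder alpha u))) 0.
Proof.
  intros Hu Hv.
  pose proof (proj1 (ex_series_incr_1 (fun n => Cmod (u n) ^ 2)) Hu) as HuS.
  set (r := fun k n => (1 - cutoff k n) ^ 2 * Cmod (ladder alpha u n) ^ 2).
  assert (Hr : forall k, ex_series (r k)).
  { intros k. apply ex_series_dominated with (2 := Hv). intros n. unfold r.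
    pose proof (cutoff_bounds k n). pose proof (Cmod_sq_nonneg (ladder alpha u n)).
    assert (0 <= (1 - cutoff k n) ^ 2 <= 1) by nra. nra. }
  set (s := Series (fun n => Cmod (u (S n)) ^ 2)).
  apply is_lim_seq_le_le with (u := fun _ => 0)
    (w := fun k => 2 * Series (r k) + (4 * s) * / (INR k + 1)).
  - intros k.
    assert (Hex : ex_series (fun n =>
        2 * r k n + 4 / (INR k + 1) * Cmod (u (S n)) ^ 2))
      by (apply ex_series_R_plus; apply ex_series_R_scal; auto).
    assert (Hb : forall n,
      0 <= Cmod (seq_minus (ladder alpha (truncate k u)) (ladder alpha u) n) ^ 2
      <= 2 * r k n + 4 / (INR k + 1) * Cmod (u (S n)) ^ 2).
    { intros n. split; [apply Cmod_sq_nonneg|].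
      replace (seq_minus (ladder alpha (truncate k u)) (ladder alpha u) n)
        with (RtoC (cutoff k n - 1) * ladder alpha u n
              + RtoC (sqrt (INR n + 1) * (cutoff k n - cutoff k (S n))) * u (S n))%C
        by (unfold seq_minus, ladder, truncate;
            rewrite RtoC_mult, !RtoC_minus; ring).
      eapply Rle_trans; [apply Cmod_sq_plus_le|].
      rewrite !Cmod_mult, !Cmod_R, !Rpow_mult_distr, !pow2_abs, Rpow_mult_distr.
      rewrite pow2_sqrt by (pose proof (pos_INR n); lra).
      pose proof (cutoff_gradient k n). pose proof (Cmod_sq_nonneg (u (S n))).
      replace (4 / (INR k + 1)) with (2 * (2 / (INR k + 1))) by lra.
      unfold r. nra. }
    split.
    + apply l2_sq_nonneg. now apply ex_series_dominated with (1 := Hb).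
    + replace ((4 * s) * / (INR k + 1)) with (4 / (INR k + 1) * s)
        by (unfold Rdiv; ring).
      unfold s. rewrite <- !Series_scal_l, <- Series_plus
        by (apply ex_series_R_scal; auto).
      now apply Series_le.
  - apply is_lim_seq_const.
  - replace (Finite 0) with (Finite (2 * 0 + (4 * s) * 0)) by (f_equal; lra).
    apply is_lim_seq_plus'; apply is_lim_seq_mult';
      try apply is_lim_seq_const.
    + now apply plateau_remainder_lim_0.
    + apply (is_lim_seq_inv (fun k => INR k + 1) p_infty); [|discriminate].
      apply is_lim_seq_ext with (fun k => INR (S k)).
      * intros k. apply S_INR.
      * apply (is_lim_seq_incr_1 INR p_infty), is_lim_seq_INR.
Qed.

Lemma truncate_form_approx (alpha : R) (u : cseq) : -1 < alpha ->
  in_l2 u -> in_l2 (ladder alpha u) ->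
  form_approx (dom_H alpha) (H_form alpha) (fun k => truncate k u) u.
Proof.
  intros Ha Hu Hv.
  assert (Hw : forall k, dom_H alpha (truncate k u))
    by (intros k; apply truncate_dom_H).
  repeat split; [exact Hu | apply Hw | apply Hw | |].
  - apply l2_norm_lim_0; [|now apply truncate_lim].
    intros k. apply l2_minus; [apply Hw | exact Hu].
  - intros eps He.
    pose proof (ladder_truncate_lim alpha u Hu Hv) as Hl.
    destruct (proj2 (is_lim_seq_spec _ 0) Hl (mkposreal (eps / 4) ltac:(lra)))
      as [N HN].
    exists N. intros k m Hk Hm.
    pose proof (HN k Hk) as H1. pose proof (HN m Hm) as H2. simpl in H1, H2.
    rewrite Rminus_0_r in H1, H2.
    apply Rabs_lt_between in H1. apply Rabs_lt_between in H2.
    assert (Hd : forall j, in_l2 (seq_minus (ladder alpha (truncate j u))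
                                           (ladder alpha u)))
      by (intros j; apply l2_minus; [now apply ladder_in_l2 | exact Hv]).
    rewrite H_form_energy by (auto using dom_H_seq_minus).
    rewrite Cmod_R, Rabs_pos_eq
      by (apply l2_sq_nonneg, ladder_in_l2; auto using dom_H_seq_minus).
    rewrite ladder_seq_minus.
    destruct (l2_bound2 (seq_minus (ladder alpha (truncate k u))
                                   (ladder alpha (truncate m u))) _ _ (Hd k) (Hd m))
      as [_ Hle]; [|lra].
    intros n. unfold seq_minus.
    replace (ladder alpha (truncate k u) n - ladder alpha (truncate m u) n)%C
      with ((ladder alpha (truncate k u) n - ladder alpha u n)
            - (ladder alpha (truncate m u) n - ladder alpha u n))%C by ring.
    apply Cmod_sq_minus_le.
Qed.

Lemma dom_t_ladder (alpha : R) (u : cseq) : -1 < alpha ->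
  dom_t alpha u <-> in_l2 u /\ in_l2 (ladder alpha u).
Proof.
  intros Ha. split.
  - intros [w Hw]. split; [apply Hw|]. now apply (form_approx_energy alpha w u).
  - intros [Hu Hv]. exists (fun k => truncate k u).
    now apply truncate_form_approx.
Qed.

Lemma filterlim_RtoC (f : nat -> R) (l : R) : is_lim_seq f l ->
  filterlim (fun k => RtoC (f k)) eventually
    (locally (T := C_UniformSpace) (RtoC l)).
Proof.
  intros H P [eps HP].
  destruct (proj2 (is_lim_seq_spec _ l) H eps) as [N HN].
  exists N. intros k Hk. apply HP. split; simpl.
  - exact (HN k Hk).
  - apply ball_center.
Qed.

Lemma form_t_energy (alpha : R) (u : cseq) : -1 < alpha -> dom_t alpha u ->
  form_t alpha u = RtoC (l2_sq (ladder alpha u)).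
Proof.
  intros Ha [w0 Hw0].
  assert (Hlim : forall w, form_approx (dom_H alpha) (H_form alpha) w u ->
    filterlim (fun k => H_form alpha (w k)) eventually
      (locally (T := C_UniformSpace) (RtoC (l2_sq (ladder alpha u))))).
  { intros w Hw.
    apply filterlim_ext with (fun k => RtoC (l2_sq (ladder alpha (w k)))).
    - intros k. symmetry. apply H_form_energy; [exact Ha | apply Hw].
    - apply filterlim_RtoC. now apply form_approx_energy. }
  refine (iota_unique (V := C_CompleteNormedModule) _ _ _ _).
  - intros l (w & Hw & Hl).
    apply (filterlim_locally_unique (K := C_AbsRing) (V := C_NormedModule)
             (F := eventually) (fun k => H_form alpha (w k))); [exact Hl|].
    now apply Hlim.
  - exists w0. split; [exact Hw0 | now apply Hlim].
Qed.

(** * The weighted Dirichlet sum *)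

Lemma sqrt_shift_diff (alpha x : R) : 0 <= x -> -1 < alpha ->
  (sqrt (x + alpha + 1) - sqrt (x + 1)) ^ 2 <= alpha ^ 2.
Proof.
  intros Hx Ha.
  assert (H1 : sqrt (x + alpha + 1) * sqrt (x + alpha + 1) = x + alpha + 1)
    by (apply sqrt_sqrt; lra).
  assert (H2 : sqrt (x + 1) * sqrt (x + 1) = x + 1) by (apply sqrt_sqrt; lra).
  pose proof (sqrt_pos (x + alpha + 1)) as H3.
  pose proof (sqrt_pos (x + 1)) as H4.
  set (a := sqrt (x + alpha + 1)) in *. set (b := sqrt (x + 1)) in *.
  assert (Hb : 1 <= b) by nra.
  replace (alpha ^ 2) with ((a - b) ^ 2 * (a + b) ^ 2).
  - pose proof (pow2_ge_0 (a - b)). assert (1 <= (a + b) ^ 2) by nra. nra.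
  - replace alpha with (a * a - b * b) by lra. ring.
Qed.

Definition weighted_diff (u : cseq) : cseq :=
  fun n => (RtoC (sqrt (INR n + 1)) * (u n - u (S n)))%C.

Lemma Cmod_sq_weighted_diff (u : cseq) (n : nat) :
  Cmod (weighted_diff u n) ^ 2 = (INR n + 1) * Cmod (Cminus (u n) (u (S n))) ^ 2.
Proof.
  unfold weighted_diff.
  rewrite Cmod_mult, Cmod_R, Rpow_mult_distr, pow2_abs, pow2_sqrt; [reflexivity|].
  pose proof (pos_INR n). lra.
Qed.

(** The difference of the two sequences is [u] times the bounded weight
    [sqrt (n + alpha + 1) - sqrt (n + 1)]. *)
Lemma ladder_weighted_diff (alpha : R) (u : cseq) : -1 < alpha -> in_l2 u ->
  in_l2 (ladder alpha u) <-> in_l2 (weighted_diff u).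
Proof.
  intros Ha Hu.
  set (d := fun n => (RtoC (sqrt (INR n + alpha + 1) - sqrt (INR n + 1)) * u n)%C).
  assert (Hd : in_l2 d).
  { apply ex_series_dominated with (fun n => alpha ^ 2 * Cmod (u n) ^ 2);
      [|now apply ex_series_R_scal].
    intros n. split; [apply Cmod_sq_nonneg|]. unfold d.
    rewrite Cmod_mult, Cmod_R, Rpow_mult_distr, pow2_abs.
    apply Rmult_le_compat_r; [apply Cmod_sq_nonneg|].
    apply sqrt_shift_diff; [apply pos_INR | exact Ha]. }
  assert (He : forall n, ladder alpha u n = (weighted_diff u n + d n)%C).
  { intros n. unfold ladder, weighted_diff, d. rewrite RtoC_minus. ring. }
  split; intros H.
  - apply (l2_bound2 _ (ladder alpha u) d H Hd). intros n.
    replace (weighted_diff u n) with (ladder alpha u n - d n)%C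
      by (rewrite He; ring).
    apply Cmod_sq_minus_le.
  - apply (l2_bound2 _ (weighted_diff u) d H Hd). intros n.
    rewrite He. apply Cmod_sq_plus_le.
Qed.

Lemma dom_t_weighted_sum (alpha : R) (u : cseq) : -1 < alpha ->
  dom_t alpha u <->
  in_l2 u /\
  ex_series (fun n => (INR n + 1) * (Cmod (Cminus (u n) (u (S n)))) ^ 2).
Proof.
  intros Ha. rewrite dom_t_ladder by exact Ha.
  assert (Hw : in_l2 (weighted_diff u) <->
    ex_series (fun n => (INR n + 1) * (Cmod (Cminus (u n) (u (S n)))) ^ 2)).
  { split; apply ex_series_ext; intros n; [|symmetry];
      apply Cmod_sq_weighted_diff. }
  rewrite <- Hw. split; intros [Hu Hv]; (split; [exact Hu|]);
    now apply (ladder_weighted_diff alpha u Ha Hu).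
Qed.

Theorem lemma3p1 :
  (forall alpha beta : R, -1 < alpha -> -1 < beta ->
     forall u : cseq, dom_t alpha u <-> dom_t beta u) /\
  (forall alpha : R, -1 < alpha ->
     (forall u : cseq,
        dom_t alpha u <->
        in_l2 u /\
        ex_series (fun n => (INR n + 1) * (Cmod (Cminus (u n) (u (S n)))) ^ 2)) /\
     (forall u : cseq, dom_t alpha u ->
        ex_series (fun n =>
          (Cmod (Cminus (Cmult (RtoC (sqrt (INR n + alpha + 1))) (u n))
                        (Cmult (RtoC (sqrt (INR n + 1))) (u (S n))))) ^ 2) /\
        form_t alpha u = RtoC (Series (fun n =>
          (Cmod (Cminus (Cmult (RtoC (sqrt (INR n + alpha + 1))) (u n))
                        (Cmult (RtoC (sqrt (INR n + 1))) (u (S n))))) ^ 2)))).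
Proof.
  split.
  - intros alpha beta Ha Hb u.
    rewrite (dom_t_weighted_sum alpha u Ha), (dom_t_weighted_sum beta u Hb).
    reflexivity.
  - intros alpha Ha. split.
    + intros u. exact (dom_t_weighted_sum alpha u Ha).
    + intros u Hu. split.
      * exact (proj2 (proj1 (dom_t_ladder alpha u Ha) Hu)).
      * exact (form_t_energy alpha u Ha Hu).
Qed.
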